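(* Let $\mathbf{n}$ be the observed table, $\mathbf{t}=\mathrm{A}^\top\mathbf{n}$ the observed sufficient statistics, and let $\mathcal{F}$ be the facial set corresponding to the face of $C_{\mathrm{A}}$ containing $\mathbf{t}$ in its relative interior. The maximum likelihood estimator (MLE) of the cell mean vector exists, is unique and identical under the Poisson and product multinomial schemes if and only if $\mathcal{F}=\mathcal{I}$. If $\mathcal{F}\subsetneq\mathcal{I}$, there exists one point $\widehat{\mathbf{m}}^{\mathrm{e}}$ in $\overline{M}$ such that $\widehat{\mathbf{m}}^{\mathrm{e}}=\lim_n\exp(\mu_n)$, where $\{\mu_n\}_n\subset\mathcal{M}$ is any optimizing sequence such that $$\lim_n\ell^P(\mu_n)=\sup_{\mu\in\mathcal{M}}\ell^P(\mu)\quad\text{and}\quad \lim_n\ell^M(\mu_n)=\sup_{\tilde\mu\in\widetilde{\mathcal{M}}}\ell^M(\tilde\mu).$$ Furthermore, $\mathrm{supp}(\widehat{\mathbf{m}}^{\mathrm{e}})=\mathcal{F}$ and $\Pi_{\mathcal{M}}\mathbf{n}=\Pi_{\mathcal{M}}\widehat{\mathbf{m}}^{\mathrm{e}}$.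
   Context: $\mathcal{I}$ is a finite set. $\mathrm{A}$ is a real $|\mathcal{I}|\times d$ matrix with nonzero rows $\mathbf{a}_i^\top$ and column span $\mathcal{M}\subset\mathbb{R}^{\mathcal{I}}$. The marginal cone $C_{\mathrm{A}}\subset\mathbb{R}^d$ is the polyhedral cone spanned by $\mathbf{a}_i$, $i\in\mathcal{I}$; the facial set corresponding to a face $F$ of $C_{\mathrm A}$ is $\{i\in\mathcal{I}:\mathbf{a}_i\in F\}$. $\Pi_{\mathcal{M}}$ is the orthogonal projector onto $\mathcal{M}$; $\mathrm{supp}(\mathbf{x})=\{i:\mathbf{x}(i)\ne0\}$; $\exp$ and $\log$ of vectors are coordinatewise; $(\cdot,\cdot)$ is the standard inner product. $\mathcal{B}_1,\ldots,\mathcal{B}_r$ is a partition of $\mathcal{I}$ with indicator functions $\chi_1,\ldots,\chi_r$; $\mathcal{N}=\mathrm{span}(\chi_1,\ldots,\chi_r)$ is strictly contained in $\mathcal{M}$. $N_1,\ldots,N_r$ are positive integers, and the observed table $\mathbf{n}\in\mathbb{N}^{\mathcal{I}}$ satisfies $(\mathbf{n},\chi_j)=N_j$ for all $j$. Poisson log-likelihood, for $\mu\in\mathcal{M}$: $$\ell^P(\mu)=(\mathbf{n},\mu)-\mathbf{1}^\top\exp(\mu)-\sum_i\log\mathbf{n}(i)!.$$ Product multinomial log-likelihood, with $\mathbf{m}=\exp(\mu)$: $$\ell^M(\mu)=\sum_{j=1}^r\Big(\sum_{i\in\mathcal{B}_j}\mathbf{n}(i)\log\frac{\mathbf{m}(i)}{(\mathbf{m},\chi_j)}+\log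 N_j!-\sum_{i\in\mathcal{B}_j}\log\mathbf{n}(i)!\Big),$$ a formula that makes sense for every $\mu\in\mathcal{M}$; the parameter set of the product multinomial scheme is $\widetilde{\mathcal{M}}=\{\mu\in\mathcal{M}:(\chi_j,\exp(\mu))=N_j,\ j=1,\ldots,r\}$. The MLE of the cell mean vector under the Poisson scheme (resp. product multinomial scheme) is $\exp(\hat\mu)$ with $\hat\mu$ a maximizer of $\ell^P$ over $\mathcal{M}$ (resp. of $\ell^M$ over $\widetilde{\mathcal{M}}$). $\overline{M}$ is the closure in $\mathbb{R}^{\mathcal{I}}$ of $\{\exp(\mu):\mu\in\mathcal{M}\}$. *)

(* Defs.v *)
From HB Require Import structures.
From mathcomp Require Import all_boot all_order all_algebra.
From mathcomp Require Import all_classical all_reals all_analysis.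

Set Implicit Arguments.
Unset Strict Implicit.
Unset Printing Implicit Defensive.

Import Order.TTheory GRing.Theory Num.Theory.
Import numFieldNormedType.Exports.

Local Open Scope classical_set_scope.
Local Open Scope ring_scope.

(* The index set is ['I_p]: [R^I] is ['cV[R]_p], with the product topology. *)

Definition dotv (R : realType) (n : nat) (x y : 'cV[R]_n) : R :=
  \sum_(i < n) x i 0 * y i 0.

Definition expv (R : realType) (n : nat) (x : 'cV[R]_n) : 'cV[R]_n :=
  map_mx expR x.
Arguments expv {R n} x.

Definition supp (R : realType) (n : nat) (x : 'cV[R]_n) : set 'I_n :=
  [set i | x i 0 != 0].

(* The [xget] default [0] is never used: see [orthoprojP]. *)
Definition orthoproj (R : realType) (n : nat) (V : {vspace 'cV[R]_n})
    (v : 'cV[R]_n) : 'cV[R]_n :=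
  xget 0 [set w | w \in V /\ forall u, u \in V -> dotv u (v - w) = 0].

Lemma dotv_mx (R : realType) (n : nat) (x y : 'cV[R]_n) :
  dotv x y = (x^T *m y) 0 0.
Proof. by rewrite mxE; apply: eq_bigr => i _; rewrite mxE. Qed.

Lemma dotv_eq0 (R : realType) (n : nat) (x : 'cV[R]_n) :
  dotv x x = 0 -> x = 0.
Proof.
move=> /eqP; rewrite psumr_eq0; last by move=> i _; rewrite -expr2 sqr_ge0.
move=> /allP h; apply/colP => i; rewrite mxE.
by have := h i (mem_index_enum _); rewrite /= mulf_eq0 orbb => /eqP.
Qed.

Lemma orthoprojP (R : realType) (n : nat) (V : {vspace 'cV[R]_n})
    (v : 'cV[R]_n) :
  orthoproj V v \in V /\
  forall u, u \in V -> dotv u (v - orthoproj V v) = 0.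
Proof.
apply: (@xgetPex _ 0
  [set w | w \in V /\ forall u, u \in V -> dotv u (v - w) = 0]).
pose B : 'M[R]_(\dim V, n) := \matrix_i ((vbasis V)`_i)^T.
have BV (x : 'rV_(\dim V)) : (x *m B)^T \in V.
  rewrite mulmx_sum_row linear_sum /=; apply: memv_suml => i _.
  by rewrite linearZ /= rowK trmxK memvZ // vbasis_mem // mem_nth // size_tuple.
have VB u : u \in V -> exists x : 'rV_(\dim V), u = (x *m B)^T.
  move=> uV; exists (\row_i coord (vbasis V) i u).
  rewrite mulmx_sum_row linear_sum /= {1}(coord_vbasis uV).
  by apply: eq_bigr => i _; rewrite linearZ /= rowK trmxK mxE.
have cap0 : (B :&: kermx B^T = 0)%MS.
  apply/eqP; rewrite -submx0; apply/row_subP => i.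
  set w := row i _.
  have : (w <= B :&: kermx B^T)%MS by exact: row_sub.
  rewrite sub_capmx => /andP[/submxP[y wy] /sub_kermxP wB].
  suff -> : w = 0 by exact: sub0mx.
  apply: trmx_inj; rewrite trmx0; apply: dotv_eq0.
  by rewrite dotv_mx trmxK [in X in _ *m X]wy trmx_mul mulmxA wB mul0mx mxE.
have rk : \rank (B *m B^T) = \rank B^T.
  by have := mxrank_mul_ker B B^T; rewrite cap0 mxrank0 addn0 mxrank_tr.
have sub : (B^T <= B *m B^T)%MS.
  by rewrite -(geq_leqif (mxrank_leqif_sup (submxMl B B^T))) rk.
have /submxP[x xE] := submx_trans (submxMl v^T B^T) sub.
exists (x *m B)^T; split; first exact: BV.
move=> u /VB[y ->]; rewrite dotv_mx trmxK.
have -> : v - (x *m B)^T = (v^T - x *m B)^T by rewrite linearB /= trmxK.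
have xv : (v^T - x *m B) *m B^T = 0 by rewrite mulmxBl xE -mulmxA subrr.
have := congr1 trmx xv; rewrite trmx_mul trmxK trmx0 => Bv.
by rewrite -mulmxA Bv mulmx0 mxE.
Qed.

Definition affine_hull (R : realType) (n : nat) (S : set 'cV[R]_n) :
    set 'cV[R]_n :=
  [set x | exists (k : nat) (w : 'I_k -> R) (y : 'I_k -> 'cV[R]_n),
     [/\ forall i, S (y i), \sum_i w i = 1 & x = \sum_i w i *: y i]].

Definition relint (R : realType) (n : nat) (S : set 'cV[R]_n) :
    set 'cV[R]_n :=
  [set x | S x /\ \forall y \near within (affine_hull S) (nbhs x), S y].

(* Faces of a polyhedron are the sets cut out by valid linear inequalities;
   [c = 0] gives [C] itself ([b = 0]) and the empty face ([b > 0]). *)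
Definition is_face (R : realType) (n : nat) (C F : set 'cV[R]_n) : Prop :=
  exists (c : 'cV[R]_n) (b : R),
    (forall x, C x -> dotv c x <= b) /\ F = C `&` [set x | dotv c x = b].

Definition arow (R : realType) (p d : nat) (A : 'M[R]_(p, d)) (i : 'I_p) :
    'cV[R]_d := (row i A)^T.

Definition marginal_cone (R : realType) (p d : nat) (A : 'M[R]_(p, d)) :
    set 'cV[R]_d :=
  [set t | exists c : 'I_p -> R,
     (forall i, 0 <= c i) /\ t = \sum_i c i *: arow A i].

Definition facial_set (R : realType) (p d : nat) (A : 'M[R]_(p, d))
    (F : set 'cV[R]_d) : set 'I_p :=
  [set i | F (arow A i)].

Definition colspan (R : realType) (p d : nat) (A : 'M[R]_(p, d)) :
    {vspace 'cV[R]_p} := <<[seq col j A | j : 'I_d]>>%VS.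

Definition is_partition (p r : nat) (B : 'I_r -> {set 'I_p}) : Prop :=
  injective B /\ finset.partition [set B j | j : 'I_r]%SET [set: 'I_p]%SET.

Definition indic_vec (R : realType) (p : nat) (B : {set 'I_p}) : 'cV[R]_p :=
  \col_i (i \in B)%:R.

Definition blockspan (R : realType) (p r : nat) (B : 'I_r -> {set 'I_p}) :
    {vspace 'cV[R]_p} := <<[seq indic_vec R (B j) | j : 'I_r]>>%VS.

Definition real_table (R : realType) (p : nat) (n : 'cV[nat]_p) : 'cV[R]_p :=
  map_mx (fun k => k%:R) n.

Definition loglik_poisson (R : realType) (p : nat) (n : 'cV[nat]_p)
    (mu : 'cV[R]_p) : R :=
  dotv (real_table R n) mu - \sum_(i < p) expv mu i 0
  - \sum_(i < p) ln ((n i 0)`!%:R).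

Definition loglik_multinomial (R : realType) (p r : nat)
    (B : 'I_r -> {set 'I_p}) (N : 'I_r -> nat) (n : 'cV[nat]_p)
    (mu : 'cV[R]_p) : R :=
  let m := expv mu in
  \sum_(j < r)
    (\sum_(i in B j) (n i 0)%:R * ln (m i 0 / dotv m (indic_vec R (B j)))
     + ln ((N j)`!%:R) - \sum_(i in B j) ln ((n i 0)`!%:R)).

Definition multinomial_params (R : realType) (p r : nat) (M : set 'cV[R]_p)
    (B : 'I_r -> {set 'I_p}) (N : 'I_r -> nat) : set 'cV[R]_p :=
  [set mu | M mu /\ forall j, dotv (indic_vec R (B j)) (expv mu) = (N j)%:R].

Definition mle_set (R : realType) (p : nat) (l : 'cV[R]_p -> R)
    (P : set 'cV[R]_p) : set 'cV[R]_p :=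
  expv @` [set mu | P mu /\ forall nu, P nu -> l nu <= l mu].

Definition optimizing_seq (R : realType) (p r : nat) (M : set 'cV[R]_p)
    (B : 'I_r -> {set 'I_p}) (N : 'I_r -> nat) (n : 'cV[nat]_p)
    (mu : nat -> 'cV[R]_p) : Prop :=
  [/\ forall k, M (mu k),
      loglik_poisson n (mu k) @[k --> \oo]
        --> sup (loglik_poisson n @` M)
    & loglik_multinomial B N n (mu k) @[k --> \oo]
        --> sup (loglik_multinomial B N n @` multinomial_params M B N)].

(* Main.v *)
Require Import Defs.
From mathcomp Require Import all_boot all_order all_algebra.
From mathcomp Require Import all_classical all_reals all_analysis.
From mathcomp Require Import ring lra.
Import Order.TTheory GRing.Theory Num.Theory.
Import numFieldNormedType.Exports.
Local Open Scope classical_set_scope.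
Local Open Scope ring_scope.

(** Everything follows from the objective [pobj y mu], the Poisson
    log-likelihood up to a constant, on the subspace [V] spanned by the
    columns of [A]. Two pieces of convex geometry control it
    ([face_certificate]). Since the sufficient statistics are relatively
    interior to the face, they are also those of a nonnegative vector [w]
    whose support is exactly the facial set; so [y] may be replaced by [w]
    in the objective, which splits it into bounded one-dimensional terms. A
    supporting hyperplane of the face gives a vector [zeta] of [V] that
    vanishes on the facial set and is negative off it.

    Limits come from an exact form of strict concavity: the objective at a
    midpoint exceeds the mean of its two values by half a sum of squared
    differences of the coordinates of [exp (mu / 2)] ([pobj_midpoint]), so
    along any two maximizing sequences these vectors come together: each is
    Cauchy, and all have the same limit. Hence [exp mu] has one limit [me]
    for all maximizing sequences ([maximizing_expv_cvg]). Perturbing such a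
    sequence in a direction of [V] shows that [y - me] is orthogonal to [V]
    ([maximizing_score]), which is the equality of projections. Tested on
    [zeta], this orthogonality makes [me] vanish off the facial set. If [w i
    > 0], the term of index [i] cannot go to minus infinity along a
    maximizing sequence, the others being bounded above, so [me i > 0]
    ([maximizing_supp]). Since [exp mu] is positive for a genuine maximizer
    [mu], a maximizer forces the facial set to be everything; conversely, if
    it is everything, [ln me] lies in [V] because subspaces are closed, and
    it is a maximizer by concavity ([maximizer_of_full_support]).

    The multinomial scheme reduces to the Poisson one. On its parameter set
    the two log-likelihoods differ by a constant, and rescaling each block
    to its prescribed total moves any point of [V] into that set without
    decreasing the Poisson log-likelihood ([renormalize_ge]). So both
    schemes have the same maximum likelihood estimates
    ([mle_set_multinomial]), and a renormalized Poisson-maximizing sequence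
    is optimizing for both ([optimizing_seq_exists]). *)

(** * Inner products and orthogonal projections *)

Section InnerProduct.
Context {R : realType} {p : nat}.
Implicit Types x y z : 'cV[R]_p.

Lemma dotvC x y : dotv x y = dotv y x.
Proof. by apply: eq_bigr => i _; rewrite mulrC. Qed.

Lemma dotvDr x y z : dotv x (y + z) = dotv x y + dotv x z.
Proof. by rewrite -big_split; apply: eq_bigr => i _ /=; rewrite mxE mulrDr. Qed.

Lemma dotvZr x (a : R) y : dotv x (a *: y) = a * dotv x y.
Proof. by rewrite mulr_sumr; apply: eq_bigr => i _; rewrite mxE mulrCA. Qed.

Lemma dotvNr x y : dotv x (- y) = - dotv x y.
Proof. by rewrite -scaleN1r dotvZr mulN1r. Qed.

Lemma dotvBr x y z : dotv x (y - z) = dotv x y - dotv x z.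
Proof. by rewrite dotvDr dotvNr. Qed.

Lemma dotv0r x : dotv x 0 = 0.
Proof. by rewrite -(scale0r 0) dotvZr mul0r. Qed.

Lemma dotv_sumr x (I : finType) (f : I -> 'cV[R]_p) :
  dotv x (\sum_i f i) = \sum_i dotv x (f i).
Proof.
by elim/big_ind2: _ => [|a b c d <- <-|//]; rewrite ?dotv0r ?dotvDr.
Qed.

(** The difference of the two projections lies in [V] and is orthogonal to
    itself. *)
Lemma orthoproj_eq {V : {vspace 'cV[R]_p}} {x y} :
  (forall u, u \in V -> dotv x u = dotv y u) -> orthoproj V x = orthoproj V y.
Proof.
move=> xy.
have [xV xP] := orthoprojP V x; have [yV yP] := orthoprojP V y.
apply/eqP; rewrite -subr_eq0; apply/eqP; apply: dotv_eq0.
set e := _ - _; have eV : e \in V by rewrite memvB.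
have := xP _ eV; have := yP _ eV; rewrite !dotvBr.
have -> : dotv e x = dotv e y by rewrite dotvC xy // dotvC.
by move=> h1 h2; lra.
Qed.

End InnerProduct.

(** * Limits of sequences of vectors *)

Section Limits.
Context {R : realType}.

Lemma cvg_sum_fin {I : finType} {f : I -> nat -> R} {l : I -> R} :
  (forall i, f i k @[k --> \oo] --> l i) ->
  \sum_i f i k @[k --> \oo] --> \sum_i l i.
Proof.
by move=> fl; apply: cvg_big => [|i _]; [exact: add_continuous|exact: fl].
Qed.

Lemma cvg_expR {u : nat -> R} {a : R} :
  u k @[k --> \oo] --> a -> expR (u k) @[k --> \oo] --> expR a.
Proof. by move=> ua; exact: (cvg_comp _ _ ua (@continuous_expR R a)). Qed.

Lemma cvg_coord {m : nat} {u : nat -> 'cV[R]_m} {v : 'cV[R]_m} (i : 'I_m) :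
  u k @[k --> \oo] --> v -> u k i 0 @[k --> \oo] --> v i 0.
Proof.
by move=> uv; exact: (cvg_comp _ _ uv (@coord_continuous R m 1 i 0 v)).
Qed.

Lemma cvg_colP {m : nat} {u : nat -> 'cV[R]_m} {v : 'cV[R]_m} :
  (forall i, u k i 0 @[k --> \oo] --> v i 0) -> u k @[k --> \oo] --> v.
Proof.
move=> uv; apply/cvg_ballP => e e0.
have near_i : \forall k \near \oo, forall i, ball (v i 0) e (u k i 0).
  by apply: filter_forall => i; move/cvg_ballP: (uv i); apply.
near=> k; split=> // i j; rewrite ord1.
by move: i; near: k.
Unshelve. all: by end_near. Qed.

Lemma cvg_dotvr {m : nat} (x : 'cV[R]_m) {u : nat -> 'cV[R]_m} {v : 'cV[R]_m} :
  u k @[k --> \oo] --> v -> dotv x (u k) @[k --> \oo] --> dotv x v.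
Proof.
move=> uv; apply: cvg_sum_fin => i; apply: cvgM; first exact: cvg_cst.
exact: cvg_coord.
Qed.

(** The residual [v - orthoproj V v] is orthogonal to every [u k], hence to the
    limit [v], hence to itself. *)
Lemma vspace_closed {m : nat} {V : {vspace 'cV[R]_m}} {u : nat -> 'cV[R]_m}
    {v : 'cV[R]_m} :
  (forall k, u k \in V) -> u k @[k --> \oo] --> v -> v \in V.
Proof.
move=> uV uv; have [PV orth] := orthoprojP V v.
suff : v - orthoproj V v = 0 by move/eqP; rewrite subr_eq0 => /eqP ->.
apply: dotv_eq0; rewrite dotvBr [X in _ - X]dotvC orth // subr0.
have h := cvg_dotvr (v - orthoproj V v) uv.
have uE : (fun k => dotv (v - orthoproj V v) (u k)) = (fun=> 0).
  by apply/funext => k; rewrite dotvC orth.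
rewrite uE in h.
exact: (norm_cvg_unique h (cvg_cst _)).
Qed.

Lemma sup_eq_lim {E : set R} {S : R} {u : nat -> R} :
  (forall x, E x -> x <= S) -> (forall k, E (u k)) ->
  u k @[k --> \oo] --> S -> sup E = S.
Proof.
move=> ubS Eu uS; apply/eqP; rewrite eq_le; apply/andP; split.
  by apply: ge_sup => //; exists (u 0%N).
apply: (cvgr_to_le uS); apply: nearW => k; apply: ub_le_sup => //.
by exists S.
Qed.

Lemma sup_cvg_seq {T : Type} {D : set T} {f : T -> R} {C : R} :
  D !=set0 -> (forall x, D x -> f x <= C) ->
  exists2 u : nat -> T, (forall k, D (u k))
    & f (u k) @[k --> \oo] --> sup (f @` D).
Proof.
move=> [x0 Dx0] ubC.
have hs : has_sup (f @` D).
  by split; [exists (f x0), x0|exists C => _ [x Dx <-]; exact: ubC].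
have hk k : exists x, D x /\ sup (f @` D) - harmonic k < f x.
  have [_ [x Dx <-] lt] := sup_adherent (harmonic_gt0 k) hs.
  by exists x.
have [u uP] := choice hk; exists u => [k|]; first by case: (uP k).
apply: (@squeeze_cvgr _ _ _ _ (fun k => sup (f @` D) - harmonic k)
  (fun=> sup (f @` D))).
- near=> k; have [Du /ltW ->] := uP k; apply: ub_le_sup; last by exists (u k).
  by case: hs.
- rewrite -[X in _ --> X]subr0; apply: cvgB; first exact: cvg_cst.
  exact: cvg_harmonic.
- exact: cvg_cst.
Unshelve. all: by end_near. Qed.

End Limits.

(** * Maximizing sequences of the Poisson objective *)

Section PoissonObjective.
Context {R : realType} {p : nat}.
Implicit Types y mu nu m : 'cV[R]_p.

Definition pobj y mu : R := dotv y mu - \sum_i expR (mu i 0).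

(** The linear part cancels, and the exponential terms are
    [(e^a + e^b) - 2 e^((a+b)/2) = (e^(a/2) - e^(b/2))^2].  This measures strict
    concavity uniformly on the whole space, in the coordinates [e^(a/2)] that
    stay bounded when [a] goes to minus infinity. *)
Lemma pobj_midpoint y mu nu :
  2 * pobj y (2^-1 *: (mu + nu)) = pobj y mu + pobj y nu
    + \sum_i (expR (mu i 0 / 2) - expR (nu i 0 / 2)) ^+ 2.
Proof.
rewrite /pobj dotvZr dotvDr mulrBr mulVKf ?pnatr_eq0 //.
suff -> : 2 * (\sum_i expR ((2^-1 *: (mu + nu)) i 0)) =
    \sum_i expR (mu i 0) + \sum_i expR (nu i 0)
    - \sum_i (expR (mu i 0 / 2) - expR (nu i 0 / 2)) ^+ 2 by lra.
rewrite -big_split -sumrB mulr_sumr; apply: eq_bigr => i _ /=.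
have sq (x : R) : expR x = expR (x / 2) ^+ 2.
  by rewrite -expRM_natr; congr expR; lra.
rewrite !mxE [2^-1 * _]mulrC [_ / 2]mulrDl expRD.
rewrite (sq (mu i 0)) (sq (nu i 0)); ring.
Qed.

Definition maximizing (V : {vspace 'cV[R]_p}) (y : 'cV[R]_p) (S : R)
    (mu : nat -> 'cV[R]_p) : Prop :=
  (forall k, mu k \in V) /\ pobj y (mu k) @[k --> \oo] --> S.

Section MaximizingSequences.
Context {V : {vspace 'cV[R]_p}} {y : 'cV[R]_p} {S : R}.
Hypothesis ubS : forall nu, nu \in V -> pobj y nu <= S.

(** The midpoint of two almost maximal points cannot exceed [S], so the squares
    in [pobj_midpoint] are small.  With [nu = mu] this is the Cauchy property;
    for two sequences it identifies their limits. *)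
Lemma maximizing_half_cauchy {mu nu : nat -> 'cV[R]_p} (i : 'I_p) {e : R} :
  maximizing V y S mu -> maximizing V y S nu -> 0 < e ->
  exists K, forall k l, (K <= k)%N -> (K <= l)%N ->
    `|expR (mu k i 0 / 2) - expR (nu l i 0 / 2)| < e.
Proof.
move=> [muV muS] [nuV nuS] e0.
have e20 : 0 < e ^+ 2 / 2 by rewrite divr_gt0 // exprn_gt0.
have [K1 _ h1] := cvgr_gt _ muS (S - e ^+ 2 / 2) ltac:(lra).
have [K2 _ h2] := cvgr_gt _ nuS (S - e ^+ 2 / 2) ltac:(lra).
exists (maxn K1 K2) => k l; rewrite !geq_max => /andP[K1k _] /andP[_ K2l].
have {}h1 := h1 k K1k; have {}h2 := h2 l K2l; rewrite /= in h1 h2.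
have := ubS (2^-1 *: (mu k + nu l)) (memvZ _ (memvD (muV k) (nuV l))).
have := pobj_midpoint y (mu k) (nu l).
set D := \sum_i _ => mid ub.
have : (expR (mu k i 0 / 2) - expR (nu l i 0 / 2)) ^+ 2 <= D.
  rewrite /D (bigD1 i) //= lerDl; apply: sumr_ge0 => j _; exact: sqr_ge0.
move=> leD; rewrite -(@ltr_pXn2r _ 2) ?nnegrE ?normr_ge0 ?(ltW e0) //.
rewrite real_normK ?num_real //; lra.
Qed.

Lemma maximizing_expv_cvg {mu : nat -> 'cV[R]_p} : maximizing V y S mu ->
  exists m, forall nu : nat -> 'cV[R]_p,
    maximizing V y S nu -> expv (nu k) @[k --> \oo] --> m.
Proof.
move=> muP.
have /choice[a muA] (i : 'I_p) : exists l : R,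
    expR (mu k i 0 / 2) @[k --> \oo] --> l.
  apply/cvg_ex/cauchy_cvgP/cauchy_exP => e e0.
  have [K hK] := maximizing_half_cauchy i muP muP e0.
  exists (expR (mu K i 0 / 2)); exists K => // k /= Kk.
  by rewrite /ball /=; exact: hK.
exists (\col_i (a i ^+ 2)) => nu nuP.
apply: cvg_colP => i; rewrite mxE.
have half : expR (nu k i 0 / 2) @[k --> \oo] --> a i.
  rewrite -[a i]addr0.
  have -> : (fun k => expR (nu k i 0 / 2)) = (fun k => expR (mu k i 0 / 2)
    + (expR (nu k i 0 / 2) - expR (mu k i 0 / 2))).
    by apply/funext => k; rewrite addrC subrK.
  apply: cvgD; first exact: muA.
  apply/cvgrPdist_lt => e e0.
  have [K hK] := maximizing_half_cauchy i nuP muP e0.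
  by exists K => // k /= Kk; rewrite sub0r normrN; exact: hK.
have -> : (fun k => expv (nu k) i 0)
    = (fun k => expR (nu k i 0 / 2) * expR (nu k i 0 / 2)).
  by apply/funext => k; rewrite mxE -expRD; congr expR; lra.
by rewrite expr2; exact: (cvgM half half).
Qed.

(** The score equations survive in the limit, even when the objective has no
    maximizer and [m] has zero coordinates. *)
Lemma maximizing_score {mu : nat -> 'cV[R]_p} {m} :
  maximizing V y S mu -> expv (mu k) @[k --> \oo] --> m ->
  forall nu, nu \in V -> dotv y nu = dotv m nu.
Proof.
move=> [muV muS] mum.
have m_ge0 i : 0 <= m i 0.
  apply: (cvgr_to_ge (cvg_coord i mum)); apply: nearW => k.
  by rewrite mxE expR_ge0.
(* The objective at [mu k + s *: nu] is at most [S]; let [k] go to infinity. *)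
have step nu s : nu \in V ->
    s * dotv y nu <= \sum_i m i 0 * (expR (s * nu i 0) - 1).
  move=> nuV.
  have lhs : pobj y (mu k) + s * dotv y nu @[k --> \oo] --> S + s * dotv y nu.
    by apply: cvgD; [exact: muS|exact: cvg_cst].
  have rhs : S + \sum_i expv (mu k) i 0 * (expR (s * nu i 0) - 1)
      @[k --> \oo] --> S + \sum_i m i 0 * (expR (s * nu i 0) - 1).
    apply: cvgD; first exact: cvg_cst.
    apply: cvg_sum_fin => i; apply: cvgM; last exact: cvg_cst.
    exact: cvg_coord.
  rewrite -(lerD2l S); apply: (ler_cvg_to lhs rhs); apply: nearW => k.
  have := ubS (mu k + s *: nu) (memvD (muV k) (memvZ s nuV)).
  rewrite /pobj dotvDr dotvZr.
  suff -> : \sum_i expR ((mu k + s *: nu) i 0) = \sum_i expR (mu k i 0)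
    + \sum_i expv (mu k) i 0 * (expR (s * nu i 0) - 1) by lra.
  rewrite -big_split; apply: eq_bigr => i _; rewrite !mxE expRD /=; ring.
have le_score nu : nu \in V -> dotv y nu <= dotv m nu.
  move=> nuV.
  (* Divide [step] by [s = 1 / (k + 1)] and let [k] go to infinity. *)
  have h : \sum_i m i 0 * (nu i 0 * expR (harmonic k * nu i 0)) @[k --> \oo]
      --> dotv m nu.
    apply: cvg_sum_fin => i; apply: cvgM; first exact: cvg_cst.
    rewrite -[X in _ --> X]mulr1; apply: cvgM; first exact: cvg_cst.
    rewrite -expR0; apply: cvg_expR.
    rewrite -(mul0r (nu i 0)); apply: cvgM; first exact: cvg_harmonic.
    exact: cvg_cst.
  apply: (cvgr_to_ge h); apply: nearW => k.
  have hk : 0 < harmonic k :> R by exact: harmonic_gt0.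
  rewrite -(ler_pM2l hk); apply: le_trans (step nu _ nuV) _.
  rewrite mulr_sumr; apply: ler_sum => i _; rewrite mulrCA.
  apply: ler_wpM2l => //; set x := harmonic k * _.
  (* [e^x - 1 <= x e^x] is [1 - x <= e^-x]. *)
  have := expR_ge1Dx (- x); rewrite expRN => le.
  have ex := expR_gt0 x.
  rewrite mulrA -/x -(ler_pM2r (x := (expR x)^-1)) ?invr_gt0 //.
  rewrite mulrBl mul1r mulfV ?gt_eqF // mulfK ?gt_eqF //; lra.
move=> nu nuV; apply/eqP; rewrite eq_le le_score //=.
by have := le_score (- nu); rewrite !dotvNr memvN lerN2; apply.
Qed.

End MaximizingSequences.

(** A critical point of a concave function is a maximizer; concavity enters as
    [e^b - e^a >= e^a (b - a)]. *)
Lemma pobj_le_score {y mu nu} :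
  dotv y (nu - mu) = dotv (expv mu) (nu - mu) -> pobj y nu <= pobj y mu.
Proof.
rewrite dotvBr => score; rewrite /pobj.
suff : dotv (expv mu) (nu - mu) <= \sum_i expR (nu i 0) - \sum_i expR (mu i 0).
  by move: score; lra.
rewrite -sumrB; apply: ler_sum => i _; rewrite !mxE.
have -> : expR (nu i 0) = expR (mu i 0) * expR (nu i 0 - mu i 0).
  by rewrite -expRD; congr expR; lra.
have := expR_ge1Dx (nu i 0 - mu i 0); have := expR_gt0 (mu i 0); nra.
Qed.

(** The tangent line of [exp] at [ln w] gives [w x - e^x <= w ln w - w].  For
    [w = 0] the right-hand side is [0] because [ln 0 = 0]. *)
Lemma scalar_bound {w : R} (x : R) : 0 <= w -> w * x - expR x <= w * ln w.
Proof.
rewrite le_eqVlt => /predU1P[<-|w0].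
  by rewrite !mul0r sub0r oppr_le0 expR_ge0.
have := expR_ge1Dx (x - ln w); rewrite expRB lnK ?posrE // ler_pdivlMr //.
by nra.
Qed.

Section Support.
Context {V : {vspace 'cV[R]_p}} {y w : 'cV[R]_p}.
Hypothesis w_ge0 : forall i, 0 <= w i 0.
Hypothesis yw : forall nu, nu \in V -> dotv y nu = dotv w nu.

Lemma pobj_coord_ub (i : 'I_p) {mu} : mu \in V ->
  pobj y mu <= w i 0 * mu i 0 - expR (mu i 0)
    + \sum_(j | j != i) w j 0 * ln (w j 0).
Proof.
move=> muV; rewrite /pobj yw // /dotv -sumrB (bigD1 i) //= lerD2l.
by apply: ler_sum => j _; exact: scalar_bound.
Qed.

Lemma pobj_ub {mu} : mu \in V -> pobj y mu <= \sum_i w i 0 * ln (w i 0).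
Proof.
move=> muV; rewrite /pobj yw // /dotv -sumrB.
by apply: ler_sum => j _; exact: scalar_bound.
Qed.

Context {zeta : 'cV[R]_p}.
Hypothesis zetaV : zeta \in V.
Hypothesis zeta_le0 : forall i, zeta i 0 <= 0.
Hypothesis zetaw : forall i, (zeta i 0 == 0) = (w i 0 != 0).

(** Where [w] vanishes, so does [m]: [dotv m zeta = dotv w zeta = 0] is a sum of
    terms of one sign.  Where [w i > 0], [pobj_coord_ub] bounds [mu k i] from
    below in terms of the objective, which converges. *)
Lemma maximizing_supp {S : R} {mu : nat -> 'cV[R]_p} {m} :
  (forall nu, nu \in V -> pobj y nu <= S) ->
  maximizing V y S mu -> expv (mu k) @[k --> \oo] --> m ->
  forall i, 0 <= m i 0 /\ (m i 0 != 0) = (w i 0 != 0).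
Proof.
move=> ubS muP mum i.
have m_ge0 j : 0 <= m j 0.
  apply: (cvgr_to_ge (cvg_coord j mum)); apply: nearW => k.
  by rewrite mxE expR_ge0.
split=> //; have [wi0|wi0] := eqVneq (w i 0) 0.
  have zi : zeta i 0 != 0 by rewrite zetaw wi0 eqxx.
  have : dotv m zeta = 0.
    rewrite -(maximizing_score ubS muP mum) // yw //; apply: big1 => j _.
    by have := zetaw j; have [->|_] := eqVneq (w j 0) 0; rewrite ?mul0r //
      => /eqP ->; rewrite mulr0.
  move/eqP; rewrite -oppr_eq0 -sumrN psumr_eq0; last first.
    by move=> j _; rewrite -mulrN mulr_ge0 // oppr_ge0.
  move=> /allP/(_ i (mem_index_enum _)).
  by rewrite oppr_eq0 mulf_eq0 (negbTE zi) orbF => /eqP ->; rewrite eqxx.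
have wi : 0 < w i 0 by rewrite lt_def wi0 w_ge0.
case: muP => muV muS.
set C := \sum_(j | j != i) w j 0 * ln (w j 0).
have low : expR ((pobj y (mu k) - C) * (w i 0)^-1) @[k --> \oo]
    --> expR ((S - C) * (w i 0)^-1).
  apply: cvg_expR.
  by apply: cvgM; [apply: cvgB => //|]; exact: cvg_cst.
rewrite gt_eqF //; apply: lt_le_trans (expR_gt0 ((S - C) * (w i 0)^-1)) _.
apply: (ler_cvg_to low (cvg_coord i mum)); apply: nearW => k.
rewrite mxE ler_expR ler_pdivrMr // lerBlDr.
apply: le_trans (pobj_coord_ub i (muV k)) _; rewrite lerD2r.
by rewrite [X in _ <= X]mulrC gerBl expR_ge0.
Qed.

End Support.

(** Positivity of the limit lets [mu k] itself converge, to [ln m], which stays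
    in the closed set [V]. *)
Lemma maximizer_of_full_support {V : {vspace 'cV[R]_p}} {y} {S : R}
    {mu : nat -> 'cV[R]_p} {m} :
  (forall nu, nu \in V -> pobj y nu <= S) ->
  maximizing V y S mu -> expv (mu k) @[k --> \oo] --> m ->
  (forall i, 0 < m i 0) ->
  exists mu0, [/\ mu0 \in V, expv mu0 = m
    & forall nu, nu \in V -> pobj y nu <= pobj y mu0].
Proof.
move=> ubS muP mum m_gt0; pose mu0 : 'cV[R]_p := \col_i ln (m i 0).
have emu0 : expv mu0 = m.
  by apply/colP => i; rewrite !mxE lnK ?posrE.
have mu0V : mu0 \in V.
  apply: (@vspace_closed _ _ V mu) => [|]; first by case: muP.
  apply: cvg_colP => i; rewrite mxE.
  have -> : (fun k => mu k i 0) = (fun k => ln (expv (mu k) i 0)).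
    by apply/funext => k; rewrite mxE expRK.
  exact: (cvg_comp _ _ (cvg_coord i mum) (continuous_ln (m_gt0 i))).
exists mu0; split=> // nu nuV; apply: pobj_le_score.
by rewrite emu0 (maximizing_score ubS muP mum) // memvB.
Qed.

End PoissonObjective.

(** * The face of the marginal cone *)

Section Faces.
Context {R : realType} {p d : nat} (A : 'M[R]_(p, d)).

Lemma mulmx_colspan (c : 'cV[R]_d) : A *m c \in colspan A.
Proof.
have -> : A *m c = \sum_j c j 0 *: col j A.
  apply/colP => i; rewrite mxE summxE; apply: eq_bigr => j _.
  by rewrite !mxE mulrC.
apply: memv_suml => j _; apply: memvZ; apply: memv_span.
by apply/mapP; exists j; rewrite ?mem_enum.
Qed.

Lemma tr_mulmx_arow (w : 'cV[R]_p) : A^T *m w = \sum_i w i 0 *: arow A i.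
Proof.
apply/colP => j; rewrite mxE summxE; apply: eq_bigr => i _.
by rewrite /arow !mxE mulrC.
Qed.

Lemma mulmx_arow (c : 'cV[R]_d) i : (A *m c) i 0 = dotv c (arow A i).
Proof. by rewrite mxE; apply: eq_bigr => j _; rewrite /arow !mxE mulrC. Qed.

Lemma dotv_colspan {y w : 'cV[R]_p} : A^T *m y = A^T *m w ->
  forall u, u \in colspan A -> dotv y u = dotv w u.
Proof.
move=> yw u; rewrite /colspan.
set s := [seq _ | _ : _]; rewrite -[s]/(tval (in_tuple s)) => us.
rewrite (coord_span us) !dotv_sumr; apply: eq_bigr => i _.
rewrite !dotvZr; congr (_ * _).
have /mapP[j _ ->] : (in_tuple s)`_i \in s by rewrite mem_nth.
have dotE (z : 'cV[R]_p) : dotv z (col j A) = (A^T *m z) j 0.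
  by rewrite mxE; apply: eq_bigr => k _; rewrite !mxE mulrC.
by rewrite !dotE yw.
Qed.

Lemma marginal_cone_arow i : marginal_cone A (arow A i).
Proof.
exists (fun j => (j == i)%:R); split=> [j|]; first exact: ler0n.
rewrite (bigD1 i) //= eqxx scale1r big1 ?addr0 // => j /negbTE ->.
by rewrite scale0r.
Qed.

(** The vector [zeta] is [A *m c] for an inequality [dotv c x <= b] cutting out
    [F]; here [b = 0] because the cone contains [0] and the multiples of the
    point [t] of [F].  For [w], let [s] be the sum of the rows of [A] in [F].
    By relative interiority [F] contains [t + h *: (t - s)] for a small
    [h > 0].  This point is a nonnegative combination of rows, of rows in [F]
    only since it lies in [F]; solving for [t] gives a combination in which
    every row in [F] has a weight at least [h / (1 + h)]. *)
Lemma face_certificate (y : 'cV[R]_p) (F : set 'cV[R]_d) :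
  is_face (marginal_cone A) F -> relint F (A^T *m y) ->
  exists w zeta : 'cV[R]_p,
    [/\ forall i, 0 <= w i 0,
        forall u, u \in colspan A -> dotv y u = dotv w u,
        zeta \in colspan A,
        forall i, zeta i 0 <= 0
      & forall i, (zeta i 0 == 0) = (w i 0 != 0)] /\
    facial_set A F = supp w.
Proof.
move=> [c [b [cb FE]]] [Ft nearF]; set t := A^T *m y in Ft nearF.
have [Ct ctb] : marginal_cone A t /\ dotv c t = b by move: Ft; rewrite FE.
have b0 : b = 0.
  apply/eqP; rewrite eq_le; apply/andP; split.
    have [a [a_ge0 tE]] := Ct.
    suff /cb : marginal_cone A (2 *: t) by rewrite dotvZr ctb; lra.
    exists (fun i => 2 * a i); split=> [i|]; first by rewrite mulr_ge0.
    by rewrite tE scaler_sumr; apply: eq_bigr => i _; rewrite scalerA.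
  have := cb 0; rewrite dotv0r; apply; exists (fun=> 0); split=> //.
  by rewrite big1 // => i _; rewrite scale0r.
rewrite {}b0 in cb FE; pose zeta := A *m c.
have zeta_le0 i : zeta i 0 <= 0.
  by rewrite mulmx_arow; apply: cb; exact: marginal_cone_arow.
have facialE i : facial_set A F i <-> zeta i 0 = 0.
  rewrite /facial_set /= FE mulmx_arow; split=> [[]//|z0]; split=> //.
  exact: marginal_cone_arow.
pose s := \sum_i (zeta i 0 == 0)%:R *: arow A i.
have Fs : F s.
  rewrite FE; split; first by exists (fun i => (zeta i 0 == 0)%:R).
  rewrite /= dotv_sumr big1 // => i _; rewrite dotvZr -mulmx_arow -/zeta.
  by case: eqVneq => [->|_]; rewrite ?mulr0 ?mul0r.
have [k Fk] : exists k : nat, F (t + harmonic k *: (t - s)).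
  have tk : t + harmonic k *: (t - s) @[k --> \oo] --> t.
    rewrite -[X in _ --> X]addr0 -(scale0r (t - s)).
    apply: cvgD; first exact: cvg_cst.
    apply: cvgZl; exact: cvg_harmonic.
  have /= [K _ hK] := tk _ nearF; exists K; apply: (hK K (leqnn K)).
  exists 2%N, (fun i => if i == 0 then 1 + harmonic K else - harmonic K),
    (fun i => if i == 0 then t else s); split.
  - by move=> i; case: ifP.
  - by rewrite big_ord_recl big_ord1 /= addrK.
  - rewrite big_ord_recl big_ord1 /= scalerDl scale1r scaleNr.
    by rewrite scalerBr addrA.
have h_gt0 : 0 < harmonic k :> R by exact: harmonic_gt0.
set h : R := harmonic k in Fk h_gt0.
have [[e [e_ge0 eE]] /= ce0] : (marginal_cone A `&` [set x | dotv c x = 0])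
    (t + h *: (t - s)) by rewrite -FE.
have e_supp i : zeta i 0 != 0 -> e i = 0.
  move=> zi; move: ce0; rewrite eE dotv_sumr => /eqP.
  rewrite -oppr_eq0 -sumrN psumr_eq0; last first.
    by move=> j _; rewrite dotvZr -mulmx_arow -mulrN mulr_ge0 // oppr_ge0.
  move=> /allP/(_ i (mem_index_enum _)).
  rewrite dotvZr -mulmx_arow oppr_eq0 mulf_eq0 -/zeta (negbTE zi) orbF.
  by move=> /eqP.
pose w : 'cV[R]_p := \col_i ((h * (zeta i 0 == 0)%:R + e i) / (1 + h)).
have h1 : 0 < 1 + h by rewrite addr_gt0.
have w_ge0 i : 0 <= w i 0.
  by rewrite mxE divr_ge0 ?(ltW h1) // addr_ge0 // mulr_ge0 // ?ltW.
have zw i : (zeta i 0 == 0) = (w i 0 != 0).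
  rewrite [w i 0]mxE; case: eqVneq => [_|zi].
    rewrite /= mulr1 gt_eqF // divr_gt0 //.
    by rewrite ltr_pwDl.
  by rewrite /= mulr0 add0r e_supp // mul0r eqxx.
exists w, zeta; split.
  split=> //; last exact: mulmx_colspan.
  apply: dotv_colspan; rewrite -/t [RHS]tr_mulmx_arow.
  have -> : \sum_i w i 0 *: arow A i =
      (1 + h)^-1 *: (h *: s + (t + h *: (t - s))).
    rewrite eE scaler_sumr -big_split scaler_sumr; apply: eq_bigr => i _ /=.
    by rewrite mxE mulrC -scalerA scalerDl scalerA.
  have -> : h *: s + (t + h *: (t - s)) = (1 + h) *: t.
    by apply/colP => j; rewrite !mxE; ring.
  by rewrite scalerA mulVf ?gt_eqF // scale1r.
apply/predeqP => i; apply: (iff_trans (facialE i)).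
by rewrite /supp /= -zw; split=> [->//|/eqP].
Qed.

End Faces.

(** * Maximizers as constant maximizing sequences *)

Section Maximizers.
Context {R : realType} {p : nat}.
Implicit Types (V : {vspace 'cV[R]_p}) (y mu nu : 'cV[R]_p).

Definition maximizer V y mu : Prop :=
  mu \in V /\ forall nu, nu \in V -> pobj y nu <= pobj y mu.

Lemma maximizing_cst V y mu :
  mu \in V -> maximizing V y (pobj y mu) (fun=> mu).
Proof. by move=> muV; split=> //; exact: cvg_cst. Qed.

Lemma maximizer_score {V y mu} : maximizer V y mu ->
  forall nu, nu \in V -> dotv y nu = dotv (expv mu) nu.
Proof.
move=> [muV mumax].
exact: (maximizing_score mumax (maximizing_cst V y mu muV) (cvg_cst _)).
Qed.

(** Two maximizers are two constant maximizing sequences, which have a common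
    limit. *)
Lemma maximizer_expv_unique {V y mu nu} :
  maximizer V y mu -> maximizer V y nu -> expv mu = expv nu.
Proof.
move=> [muV mumax] [nuV numax].
have muP := maximizing_cst V y mu muV.
have nuP : maximizing V y (pobj y mu) (fun=> nu).
  have -> : pobj y mu = pobj y nu by apply/eqP; rewrite eq_le mumax ?numax.
  exact: maximizing_cst.
have [m mP] := maximizing_expv_cvg mumax muP.
rewrite (norm_cvg_unique (cvg_cst _) (mP _ muP)).
by rewrite (norm_cvg_unique (cvg_cst _) (mP _ nuP)).
Qed.

Lemma loglik_poisson_pobj (n : 'cV[nat]_p) mu :
  loglik_poisson n mu = pobj (real_table R n) mu - \sum_i ln ((n i 0)`!%:R).
Proof.
rewrite /loglik_poisson /pobj; congr (_ - _ - _).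
by apply: eq_bigr => i _; rewrite mxE.
Qed.

Lemma maximizer_poissonP (n : 'cV[nat]_p) V mu :
  maximizer V (real_table R n) mu <->
  mu \in V /\ forall nu, nu \in V -> loglik_poisson n nu <= loglik_poisson n mu.
Proof.
by split=> -[muV mumax]; split=> // nu nuV; have := mumax nu nuV;
  rewrite !loglik_poisson_pobj lerD2r.
Qed.

End Maximizers.

(** * Comparison with the product multinomial scheme *)

Section ProductMultinomial.
Context {R : realType} {p r : nat}.
Context {B : 'I_r -> {set 'I_p}} {N : 'I_r -> nat} {n : 'cV[nat]_p}.
Hypothesis partB : is_partition B.
Hypothesis N_gt0 : forall j, (0 < N j)%N.
Hypothesis tableN :
  forall j, dotv (real_table R n) (indic_vec R (B j)) = (N j)%:R.
Context {V : {vspace 'cV[R]_p}}.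
Hypothesis indicV : forall j, indic_vec R (B j) \in V.

Let y := real_table R n.
Let M : set 'cV[R]_p := [set mu | mu \in V].
Let Mt := multinomial_params M B N.
Let lP : 'cV[R]_p -> R := loglik_poisson n.
Let lM : 'cV[R]_p -> R := loglik_multinomial B N n.

Lemma partition_index : exists beta : 'I_p -> 'I_r,
  forall i j, (i \in B j) = (j == beta i).
Proof.
have [injB /and3P[/eqP covB trivB _]] := partB.
suff /choice[beta betaP] : forall i, exists k, forall j, (i \in B j) = (j == k).
  by exists beta.
move=> i.
have : i \in finset.cover [set B j | j : 'I_r]%SET by rewrite covB finset.inE.
move=> /bigcupP[_ /imsetP[j0 _ ->] ij0]; exists j0 => j.
apply/idP/eqP => [ij|->//]; apply: injB.
have inP k : B k \in [set B j | j : 'I_r]%SET by apply/imsetP; exists k.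
rewrite -(def_pblock trivB (inP j) ij).
by rewrite (def_pblock trivB (inP j0) ij0).
Qed.

Lemma partition_sum (f : 'I_p -> R) :
  \sum_i f i = \sum_j \sum_(i in B j) f i.
Proof.
have [beta betaP] := partition_index.
rewrite (exchange_big_dep xpredT) //=; apply: eq_bigr => i _.
by under eq_bigl => j do rewrite betaP; rewrite big_pred1_eq.
Qed.

Lemma dotv_indic (x : 'cV[R]_p) j :
  dotv x (indic_vec R (B j)) = \sum_(i in B j) x i 0.
Proof.
rewrite [RHS]big_mkcond; apply: eq_bigr => i _; rewrite mxE.
by case: ifP; rewrite ?mulr1 ?mulr0.
Qed.

Definition block_mean (mu : 'cV[R]_p) (j : 'I_r) : R :=
  dotv (expv mu) (indic_vec R (B j)).

Lemma block_mean_gt0 mu j : 0 < block_mean mu j.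
Proof.
have [_ /and3P[_ _ B0]] := partB.
have /set0Pn[i iBj] : B j != finset.set0.
  by apply: contraNneq B0 => <-; apply/imsetP; exists j.
rewrite /block_mean dotv_indic (bigD1 i) //= ltr_pwDl ?mxE ?expR_gt0 //.
by apply: sumr_ge0 => k _; rewrite mxE expR_ge0.
Qed.

Lemma multinomial_paramsP mu :
  Mt mu <-> mu \in V /\ forall j, block_mean mu j = (N j)%:R.
Proof.
by split=> -[muV h]; split=> // j; rewrite -h /block_mean dotvC.
Qed.

Lemma loglik_multinomialE mu :
  lM mu = dotv y mu - \sum_j (N j)%:R * ln (block_mean mu j)
    + \sum_j ln ((N j)`!%:R) - \sum_i ln ((n i 0)`!%:R).
Proof.
rewrite /lM /loglik_multinomial /dotv !partition_sum -sumrB -big_split -sumrB.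
apply: eq_bigr => j _ /=; congr (_ + _ - _).
rewrite -tableN dotv_indic mulr_suml -sumrB; apply: eq_bigr => i _.
rewrite -/(dotv _ _) -/(block_mean mu j).
rewrite lnM ?posrE ?invr_gt0 ?block_mean_gt0 //.
  by rewrite lnV ?posrE ?block_mean_gt0 // !mxE expRK mulrBr.
by rewrite mxE expR_gt0.
Qed.

(** The constant by which [loglik_multinomial] exceeds [loglik_poisson] on the
    multinomial parameter set. *)
Definition scheme_gap : R :=
  \sum_j ((N j)%:R - (N j)%:R * ln (N j)%:R + ln ((N j)`!%:R)).

Lemma loglik_multinomial_poisson {mu} : Mt mu -> lM mu = lP mu + scheme_gap.
Proof.
move=> /multinomial_paramsP[_ h]; rewrite loglik_multinomialE.
rewrite /lP loglik_poisson_pobj.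
have -> : pobj y mu = dotv y mu - \sum_j (N j)%:R.
  rewrite /pobj partition_sum; congr (_ - _); apply: eq_bigr => j _.
  by rewrite -h /block_mean dotv_indic; apply: eq_bigr => i _; rewrite mxE.
rewrite /scheme_gap big_split sumrB /=.
under eq_bigr => j _ do rewrite h.
ring.
Qed.

(** The shift lies in [V], as the indicators do, and multiplies the means of
    block [j] by [N j / block_mean mu j]. *)
Definition renormalize (mu : 'cV[R]_p) : 'cV[R]_p :=
  mu + \sum_j ln ((N j)%:R / block_mean mu j) *: indic_vec R (B j).

Lemma renormalize_ratio_gt0 mu j : 0 < (N j)%:R / block_mean mu j.
Proof. by rewrite divr_gt0 ?ltr0n ?block_mean_gt0. Qed.

Lemma expv_renormalize {mu i j} : i \in B j ->
  expv (renormalize mu) i 0 = expv mu i 0 * ((N j)%:R / block_mean mu j).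
Proof.
have [beta betaP] := partition_index; rewrite betaP => /eqP jE.
rewrite mxE /renormalize mxE expRD summxE (bigD1 j) //= big1 => [|k kj].
  rewrite addr0 !mxE betaP -jE eqxx mulr1 lnK ?posrE ?renormalize_ratio_gt0 //.
by rewrite !mxE betaP -jE (negbTE kj) mulr0.
Qed.

Lemma renormalize_params {mu} : mu \in V -> Mt (renormalize mu).
Proof.
move=> muV; apply/multinomial_paramsP; split=> [|j].
  by rewrite memvD // memv_suml // => j _; exact: memvZ.
rewrite /block_mean dotv_indic.
under eq_bigr => i ij do rewrite (expv_renormalize ij).
rewrite -mulr_suml -dotv_indic -/(block_mean mu j) mulrC divfK //.
by rewrite gt_eqF ?block_mean_gt0.
Qed.

(** Scaling a block of total [s] to its total [N] changes its contribution from
    [N ln s - s] to [N ln N - N], the maximum over [s], up to terms that do not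
    depend on [s]. *)
Lemma renormalize_ge {mu} : mu \in V -> lP mu <= lP (renormalize mu).
Proof.
move=> muV; rewrite /lP !loglik_poisson_pobj lerD2r /pobj !partition_sum.
have sumE (nu : 'cV[R]_p) j : \sum_(i in B j) expR (nu i 0) = block_mean nu j.
  by rewrite /block_mean dotv_indic; apply: eq_bigr => i _; rewrite mxE.
have /multinomial_paramsP[_ massN] := renormalize_params muV.
under eq_bigr do rewrite sumE.
under [X in _ <= _ - X]eq_bigr do rewrite sumE massN.
rewrite /renormalize dotvDr dotv_sumr -addrA lerD2l.
rewrite -!sumrN -big_split; apply: ler_sum => j _ /=.
rewrite dotvZr tableN.
have s0 := block_mean_gt0 mu j; have N0 : 0 < (N j)%:R :> R by rewrite ltr0n.
(* The tangent-line bound [1 + x <= e^x] at [x = ln (s / N)]. *)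
have := expR_ge1Dx (- ln ((N j)%:R / block_mean mu j)).
rewrite expRN lnK ?posrE ?renormalize_ratio_gt0 // invf_div ler_pdivlMr //.
by nra.
Qed.

(** The score equations along the block indicators. *)
Lemma maximizer_params {mu} : maximizer V y mu -> Mt mu.
Proof.
move=> muP; have [muV _] := muP.
apply/multinomial_paramsP; split=> // j.
by rewrite /block_mean -(maximizer_score muP) // tableN.
Qed.

(** A multinomial maximizer beats every [nu] of [V] because it beats the
    renormalization of [nu].  Conversely a Poisson maximizer satisfies the
    multinomial constraints ([maximizer_params]), and there the two
    log-likelihoods differ by a constant. *)
Lemma mle_set_multinomial : mle_set lM Mt = mle_set lP M.
Proof.
congr (expv @` _); apply/predeqP => mu; split.
  move=> [/[dup] muT /multinomial_paramsP[muV _] mumax]; split=> // nu nuV.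
  apply: le_trans (renormalize_ge nuV) _.
  have nuT := renormalize_params nuV.
  by have := mumax _ nuT; rewrite !loglik_multinomial_poisson // lerD2r.
move=> /[dup] [[_ mumax]] /maximizer_poissonP/maximizer_params muT.
split=> // nu nuT; rewrite !loglik_multinomial_poisson // lerD2r.
by apply: mumax; have [] := multinomial_paramsP nu; case/(_ nuT).
Qed.

(** Renormalizing a Poisson-maximizing sequence keeps it maximizing and puts it
    in the multinomial parameter set, where one log-likelihood follows the
    other. *)
Lemma optimizing_seq_exists {C : R} : (forall mu, M mu -> lP mu <= C) ->
  exists mu, optimizing_seq M B N n mu.
Proof.
move=> ubC; have M0 : M !=set0 by exists 0; exact: mem0v.
have [mu muM muS] := sup_cvg_seq M0 ubC.
have nuT k : Mt (renormalize (mu k)) by exact: (renormalize_params (muM k)).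
have TM nu : Mt nu -> M nu by case.
have ub nu : M nu -> lP nu <= sup (lP @` M).
  move=> nuM; apply: ub_le_sup; last by exists nu.
  by exists C => _ [? ? <-]; exact: ubC.
have nuS : lP (renormalize (mu k)) @[k --> \oo] --> sup (lP @` M).
  apply: (squeeze_cvgr _ muS (cvg_cst _)); apply: nearW => k.
  by rewrite (renormalize_ge (muM k)) ub //; exact: TM.
have nuSM : lM (renormalize (mu k)) @[k --> \oo]
    --> sup (lP @` M) + scheme_gap.
  have -> : (fun k => lM (renormalize (mu k)))
      = (fun k => lP (renormalize (mu k)) + scheme_gap).
    by apply/funext => k; rewrite loglik_multinomial_poisson.
  by apply: cvgD nuS (cvg_cst _).
exists (fun k => renormalize (mu k)); split=> [k| |]; first exact: TM.
  exact: nuS.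
suff -> : sup (lM @` Mt) = sup (lP @` M) + scheme_gap by exact: nuSM.
apply: (sup_eq_lim _ _ nuSM) => [_ [nu nuT' <-]|k].
  by rewrite loglik_multinomial_poisson // lerD2r; apply: ub; exact: TM.
by exists (renormalize (mu k)).
Qed.

End ProductMultinomial.

(** * Existence, uniqueness and the extended estimator *)

Theorem theorem9 (R : realType) (p d r : nat) (A : 'M[R]_(p, d))
    (B : 'I_r -> {set 'I_p}) (N : 'I_r -> nat) (n : 'cV[nat]_p)
    (F : set 'cV[R]_d)
    (M : set 'cV[R]_p := [set mu | mu \in colspan A])
    (lP : 'cV[R]_p -> R := loglik_poisson n)
    (lM : 'cV[R]_p -> R := loglik_multinomial B N n)
    (Mt : set 'cV[R]_p := multinomial_params M B N) :
  (forall i, row i A != 0) ->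
  is_partition B ->
  (blockspan R B <= colspan A)%VS -> blockspan R B != colspan A ->
  (forall j, (0 < N j)%N) ->
  (forall j, dotv (real_table R n) (indic_vec R (B j)) = (N j)%:R) ->
  is_face (marginal_cone A) F ->
  relint F (A^T *m real_table R n) ->
  [/\ (exists m, mle_set lP M = [set m] /\ mle_set lM Mt = [set m])
        <-> facial_set A F = setT,
      (mle_set lP M !=set0 <-> facial_set A F = setT) /\
      (mle_set lM Mt !=set0 <-> facial_set A F = setT)
    & facial_set A F `<` setT ->
      (exists mu, optimizing_seq M B N n mu) /\
      exists me : 'cV[R]_p,
        [/\ unique (fun m => closure (expv @` M) m /\
              forall mu, optimizing_seq M B N n mu ->
                expv (mu k) @[k --> \oo] --> m) me,
            supp me = facial_set A F
          & orthoproj (colspan A) (real_table R n)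
            = orthoproj (colspan A) me]].
Proof.
move=> _ partB BV _ N_gt0 tableN faceF tF.
have indicV j : indic_vec R (B j) \in colspan A.
  apply: (subvP BV); apply: memv_span.
  by apply/mapP; exists j; rewrite ?mem_enum.
have [w [zeta [[w_ge0 yw zetaV zeta_le0 zetaw] FE]]] :=
  face_certificate _ _ _ faceF tF.
set V := colspan A in M Mt BV indicV yw zetaV *; pose y := real_table R n.
pose K : R := \sum_i ln ((n i 0)`!%:R).
have lPE mu : lP mu = pobj y mu - K by exact: loglik_poisson_pobj.
have M0 : M !=set0 by exists 0; exact: mem0v.
have ubC mu : M mu -> lP mu <= \sum_i w i 0 * ln (w i 0) - K.
  by move=> muV; rewrite lPE lerD2r; exact: (pobj_ub w_ge0 yw).
pose S := sup (lP @` M) + K.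
have ubS mu : mu \in V -> pobj y mu <= S.
  move=> muV; rewrite -lerBlDr -lPE; apply: ub_le_sup; last by exists mu.
  by eexists => _ [nu nuV <-]; exact: ubC.
have maxP mu : (forall k, M (mu k)) ->
    lP (mu k) @[k --> \oo] --> sup (lP @` M) -> maximizing V y S mu.
  move=> muV muS; split=> //.
  have -> : (fun k => pobj y (mu k)) = (fun k => lP (mu k) + K).
    by apply/funext => k; rewrite lPE subrK.
  by apply: cvgD muS (cvg_cst _).
have [mu muV muS] := sup_cvg_seq M0 ubC.
have {muV muS} muP := maxP mu muV muS.
have [me meP] := maximizing_expv_cvg ubS muP.
have mesupp :=
  maximizing_supp w_ge0 yw zetaV zeta_le0 zetaw ubS muP (meP _ muP).
have full_of_maximizer mu0 : maximizer V y mu0 -> facial_set A F = setT.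
  move=> [mu0V mu0max]; rewrite FE; apply/seteqP; split=> // i _.
  have [_ ] := maximizing_supp w_ge0 yw zetaV zeta_le0 zetaw mu0max
    (maximizing_cst V y mu0 mu0V) (cvg_cst _) i.
  by rewrite mxE gt_eqF ?expR_gt0 // /supp /= => <-.
have full_of_mle : mle_set lP M !=set0 -> facial_set A F = setT.
  by move=> [_ [mu0 /maximizer_poissonP mu0P _]]; exact: full_of_maximizer mu0P.
have mle_of_full : facial_set A F = setT -> mle_set lP M = [set me].
  move=> full; have me_gt0 i : 0 < me i 0.
    have [me_ge0 meE] := mesupp i; rewrite lt_def me_ge0 meE andbT.
    by have : supp w i by rewrite -FE full.
  have [mu0 [mu0V emu0 mu0max]] :=
    maximizer_of_full_support ubS muP (meP _ muP) me_gt0.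
  have mu0P : maximizer V y mu0 by [].
  apply/seteqP; split=> [_ [nu /maximizer_poissonP nuP <-]|_ ->].
    by rewrite -emu0 /=; exact: maximizer_expv_unique nuP mu0P.
  by exists mu0 => //; exact/maximizer_poissonP.
have mleE : mle_set lM Mt = mle_set lP M.
  exact: (mle_set_multinomial partB N_gt0 tableN indicV).
split.
- rewrite mleE; split=> [[m [mleP _]]|/mle_of_full mleP]; last by exists me.
  by apply: full_of_mle; rewrite mleP; exists m.
- rewrite mleE; suff h : mle_set lP M !=set0 <-> facial_set A F = setT by [].
  by split=> [//|/mle_of_full ->]; exists me.
move=> _.
have [nu nuP] := optimizing_seq_exists partB N_gt0 tableN indicV ubC.
have meP' xi : optimizing_seq M B N n xi -> expv (xi k) @[k --> \oo] --> me.
  by move=> [xiV xiS _]; apply: meP; exact: maxP.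
split; first by exists nu.
exists me; split.
- split=> [|m [_ mP]]; last exact: (norm_cvg_unique (meP' _ nuP) (mP _ nuP)).
  split=> //; have [nuV _ _] := nuP.
  apply: (closed_cvg _ (@closed_closure _ (expv @` M)) _ _ (meP' _ nuP)).
  apply: nearW => k; apply: subset_closure; exists (nu k) => //; exact: nuV.
- rewrite FE; apply/predeqP => i; rewrite /supp /=.
  by have [_ ->] := mesupp i.
by apply: orthoproj_eq; exact: (maximizing_score ubS muP (meP _ muP)).
Qed.
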